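(* Let $X$ be a real-valued random variable with finite moments of all orders, with moments $\mu_n=\mathbb{E}(X^n)$ and cumulants $(\kappa_n)_{n\ge 0}$ defined by the formal power series identity $$\exp\Big(\sum_{n\ge 0}\frac{t^n}{n!}\kappa_n\Big)=\sum_{n\ge 0}\frac{t^n}{n!}\mu_n ,$$ so that $\mu_0=1$ and $\kappa_0=0$. Let $H=\mathbb{R}[x]$ and define $\mu,\kappa\in H^*$ by $\mu(x^n):=\mu_n$ and $\kappa(x^n):=\kappa_n$ for $n\ge 0$. Then $$\mu=\exp^\star(\kappa):=\varepsilon+\sum_{n\ge 1}\frac{1}{n!}\kappa^{\star n},\qquad \kappa=\log^\star(\mu):=\sum_{n\ge 1}\frac{(-1)^{n-1}}{n}(\mu-\varepsilon)^{\star n},$$ where $\varepsilon(x^k):=\mathbf 1_{(k=0)}$.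
   Context: $H=\mathbb{R}[x]$ carries the coproduct $\Delta x^n=\sum_{k=0}^n\binom{n}{k}x^{n-k}\otimes x^k$. For $\alpha,\beta\in H^*$, the convolution product is $(\alpha\star\beta)(x^n):=(\alpha\otimes\beta)\Delta x^n$; it is associative and commutative with unit $\varepsilon$, and $\alpha^{\star n}$ is the $n$-fold convolution power. The infinite sums are understood pointwise: evaluated on any element of $H$ only finitely many terms are nonzero. *)

(* Defs.v *)
From HB Require Import structures.
From mathcomp Require Import all_boot all_order all_algebra.
From mathcomp Require Import all_classical all_reals all_analysis.

Set Implicit Arguments.
Unset Strict Implicit.
Unset Printing Implicit Defensive.

Import Order.TTheory GRing.Theory Num.Theory.
Import numFieldNormedType.Exports.

Local Open Scope classical_set_scope.
Local Open Scope ring_scope.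

Section Coalgebra.
Variable R : comNzRingType.
Implicit Types (p q : {poly R}) (F G : {poly {poly R}}).

(* The dual H^* of H = R[x] is {scalar {poly R}}. A sequence of scalars m
   determines the functional sending 'X^n to m n. *)
Definition functional (m : nat -> R) p : R := \sum_(i < size p) p`_i * m i.

Lemma functional_widen (m : nat -> R) N p : (size p <= N)%N ->
  functional m p = \sum_(i < N) p`_i * m i.
Proof.
move=> pN; rewrite /functional (big_ord_widen N (fun i => p`_i * m i) pN).
rewrite big_mkcond; apply: eq_bigr => i _.
by case: ltnP => // /(nth_default 0) ->; rewrite mul0r.
Qed.

Fact functional_is_scalar (m : nat -> R) : scalar (functional m).
Proof.
move=> a p q; set N := maxn (size p) (maxn (size q) (size (a *: p + q))).
rewrite !(@functional_widen m N) ?leq_max ?leqnn ?orbT //.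
rewrite mulr_sumr -big_split; apply: eq_bigr => i _ /=.
by rewrite coefD coefZ mulrDl mulrA.
Qed.

HB.instance Definition _ (m : nat -> R) :=
  GRing.isLinear.Build R {poly R} R *%R (functional m)
    (functional_is_scalar m).

Lemma functionalXn (m : nat -> R) n : functional m 'X^n = m n.
Proof.
rewrite /functional size_polyXn big_ord_recr /= coefXn eqxx mul1r big1 ?add0r //.
by move=> i _; rewrite coefXn ltn_eqF ?mul0r.
Qed.

Definition counit : {scalar {poly R}} := functional (fun k => (k == 0%N)%:R).

(* H (x) H is modelled by polynomials in a second variable over R[x]: the
   inner variable carries the left tensor factor, the outer one the right. *)
Definition tensor p q : {poly {poly R}} := p *: q^:P.

Definition coproductXn n : {poly {poly R}} :=
  \sum_(k < n.+1) tensor 'X^(n - k) 'X^k *+ 'C(n, k).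

Definition coproduct p : {poly {poly R}} :=
  \sum_(n < size p) (p`_n)%:P *: coproductXn n.

(* alpha (x) beta, see tensor_functionalE *)
Definition tensor_functional (alpha beta : {scalar {poly R}}) F : R :=
  \sum_(j < size F) alpha F`_j * beta 'X^j.

Lemma scalar_polyE (beta : {scalar {poly R}}) p :
  beta p = functional (fun n => beta 'X^n) p.
Proof.
rewrite -[p in LHS]coefK poly_def linear_sum.
by apply: eq_bigr => i _; rewrite linearZ.
Qed.

Lemma coproduct_widen N p : (size p <= N)%N ->
  coproduct p = \sum_(n < N) (p`_n)%:P *: coproductXn n.
Proof.
move=> pN.
rewrite /coproduct (big_ord_widen N (fun n => (p`_n)%:P *: coproductXn n) pN).
rewrite big_mkcond; apply: eq_bigr => i _.
by case: ltnP => // /(nth_default 0) ->; rewrite scale0r.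
Qed.

Lemma coproductE n : coproduct 'X^n = coproductXn n.
Proof.
rewrite /coproduct size_polyXn big_ord_recr /= coefXn eqxx scale1r.
by rewrite big1 ?add0r // => i _; rewrite coefXn ltn_eqF ?scale0r.
Qed.

Lemma coproduct_linear a p q :
  coproduct (a *: p + q) = a%:P *: coproduct p + coproduct q.
Proof.
set N := maxn (size p) (maxn (size q) (size (a *: p + q))).
rewrite !(@coproduct_widen N) ?leq_max ?leqnn ?orbT //.
rewrite scaler_sumr -big_split; apply: eq_bigr => i _ /=.
by rewrite coefD coefZ polyCD polyCM scalerDl scalerA.
Qed.

Lemma tensor_functional_widen alpha beta N F : (size F <= N)%N ->
  tensor_functional alpha beta F = \sum_(j < N) alpha F`_j * beta 'X^j.
Proof.
move=> FN; rewrite /tensor_functional.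
rewrite (big_ord_widen N (fun j => alpha F`_j * beta 'X^j) FN).
rewrite big_mkcond; apply: eq_bigr => i _.
by case: ltnP => // /(nth_default 0) ->; rewrite linear0 mul0r.
Qed.

Lemma tensor_functional_linear alpha beta a F G :
  tensor_functional alpha beta (a%:P *: F + G) =
  a * tensor_functional alpha beta F + tensor_functional alpha beta G.
Proof.
set N := maxn (size F) (maxn (size G) (size (a%:P *: F + G))).
rewrite !(@tensor_functional_widen alpha beta N) ?leq_max ?leqnn ?orbT //.
rewrite mulr_sumr -big_split; apply: eq_bigr => i _ /=.
by rewrite coefD coefZ mul_polyC linearP mulrDl mulrA.
Qed.

Lemma tensor_functionalE alpha beta p q :
  tensor_functional alpha beta (tensor p q) = alpha p * beta q.
Proof.
rewrite (@tensor_functional_widen _ _ (size q)); last first.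
  by rewrite (leq_trans (size_scale_leq _ _)) // size_map_polyC.
rewrite (scalar_polyE beta q) mulr_sumr; apply: eq_bigr => j _.
rewrite coefZ coef_map /= [p * _]mulrC. rewrite mul_polyC linearZ /=.
by rewrite -mulrA mulrCA.
Qed.

Definition convolution (alpha beta : {scalar {poly R}}) p : R :=
  tensor_functional alpha beta (coproduct p).

Fact convolution_is_scalar alpha beta : scalar (convolution alpha beta).
Proof.
move=> a p q.
by rewrite /convolution coproduct_linear tensor_functional_linear.
Qed.

HB.instance Definition _ (alpha beta : {scalar {poly R}}) :=
  GRing.isLinear.Build R {poly R} R *%R (convolution alpha beta)
    (convolution_is_scalar alpha beta).

Lemma tensor_functional_sum alpha beta n (F : 'I_n -> {poly {poly R}}) :
  tensor_functional alpha beta (\sum_i F i) =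
  \sum_i tensor_functional alpha beta (F i).
Proof.
have D G1 G2 : tensor_functional alpha beta (G1 + G2) =
    tensor_functional alpha beta G1 + tensor_functional alpha beta G2.
  by rewrite -[G1]scale1r tensor_functional_linear mul1r scale1r.
apply: (big_morph _ D).
by rewrite /tensor_functional size_poly0 big_ord0.
Qed.

Lemma convolutionXn alpha beta n :
  convolution alpha beta 'X^n =
  \sum_(k < n.+1) alpha 'X^(n - k) * beta 'X^k *+ 'C(n, k).
Proof.
rewrite /convolution coproductE tensor_functional_sum; apply: eq_bigr => k _.
rewrite -tensor_functionalE -[in LHS]scaler_nat -polyC_natr.
rewrite -[_ *: _]addr0 tensor_functional_linear mulr_natl.
by rewrite /tensor_functional size_poly0 big_ord0 addr0.
Qed.

Definition convolution_power (alpha : {scalar {poly R}}) n :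
    {scalar {poly R}} :=
  iter n (fun gamma => convolution alpha gamma : {scalar {poly R}}) counit.

End Coalgebra.

Section ExpLog.
Variable R : realType.
Implicit Types (alpha : {scalar {poly R}}) (p : {poly R}).

Definition exp_term alpha n p : R := n`!%:R^-1 * convolution_power alpha n p.

Definition log_term alpha n p : R :=
  (-1) ^+ n.-1 / n%:R * convolution_power (alpha \- @counit R) n p.

(* A family of functions on H, indexed by n >= 1, with pointwise only finitely
   many nonzero terms. *)
Definition pointwise_finite (a : nat -> {poly R} -> R) : Prop :=
  forall p, finite_set [set n | (1 <= n)%N /\ a n p != 0].

(* The sums below are finitely supported sums (fsbigop), which only have their
   intended meaning for families satisfying pointwise_finite. *)
Definition exp_convolution alpha p : R :=
  counit R p + \sum_(n \in [set n | (1 <= n)%N]) exp_term alpha n p.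

Definition log_convolution alpha p : R :=
  \sum_(n \in [set n | (1 <= n)%N]) log_term alpha n p.

(* A formal power series in t is its sequence of coefficients. *)
Definition fps_mul (f g : nat -> R) (n : nat) : R :=
  \sum_(k < n.+1) f k * g (n - k)%N.

Definition fps_pow (f : nat -> R) (k : nat) : nat -> R :=
  iter k (fps_mul f) (fun n => (n == 0%N)%:R).

(* exp f = \sum_k f^k / k!, coefficientwise: the n-th coefficient is a finite
   sum (only k <= n contribute) when f 0 = 0, and a convergent series of real
   numbers in general, so that no condition on f 0 is needed. *)
Definition fps_exp (f : nat -> R) (n : nat) : R :=
  limn (series (fun k => fps_pow f k n / k`!%:R)).

Definition egf (a : nat -> R) (n : nat) : R := a n / n`!%:R.

Definition are_cumulants (moments kappa : nat -> R) : Prop :=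
  fps_exp (egf kappa) =1 egf moments.

End ExpLog.

Section Moments.
Context (d : measure_display) (T : measurableType d) (R : realType).
Variables (P : probability T R) (X : {RV P >-> R}).

Definition finite_moments : Prop :=
  forall n, P.-integrable setT (fun w => (X w ^+ n)%:E).

Definition moment (n : nat) : R := fine 'E_P[fun w => X w ^+ n].

End Moments.

(* Main.v *)
(* Dividing the value at 'X^n by n! turns convolution of functionals into the
   Cauchy product of power series, so both claims are coefficientwise statements
   about exp and log of a series without constant term. The one nontrivial
   identity, log (exp f) = f, is reduced to the univariate congruence
   L_N(E_N(X) - 1) = X modulo X^(N+1) between truncated series, by substituting
   (a truncation of) f for X; that congruence holds since the derivative of its
   left-hand side is 1 modulo X^N. *)
Require Import Defs.
From HB Require Import structures.
From mathcomp Require Import all_boot all_order all_algebra.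
From mathcomp Require Import all_classical all_reals all_analysis.
From mathcomp Require Import ring.

Set Implicit Arguments.
Unset Strict Implicit.
Unset Printing Implicit Defensive.

Import Order.TTheory GRing.Theory Num.Theory.
Import numFieldNormedType.Exports.

Local Open Scope classical_set_scope.
Local Open Scope ring_scope.

(** * Truncated exponential and logarithm as polynomials *)

Section TruncatedPolynomials.
Variable K : numFieldType.
Implicit Types p q r : {poly K}.

Lemma dvdXnP n p : reflect (forall i, (i < n)%N -> p`_i = 0) ('X^n %| p).
Proof.
apply: (iffP idP) => [/dvdpP[q ->] i lin|p0]; first by rewrite coefMXn lin.
rewrite -(poly_take_drop n p) dvdp_addl ?dvdp_mull //.
suff -> : take_poly n p = 0 by exact: dvdp0.
by apply/polyP => i; rewrite coef_take_poly coef0; case: ifP => // /p0.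
Qed.

(** Each [q ^+ i - r ^+ i] is a multiple of [q - r]. This allows the inner polynomial of a
    composition to be changed modulo a power of ['X]. *)
Lemma dvdp_sub_comp p q r : q - r %| (p \Po q) - (p \Po r).
Proof.
rewrite !comp_polyE -sumrB.
elim/big_ind: _ => [|u v|i _]; [exact: dvdp0 | exact: dvdp_add |].
by rewrite -scalerBr -mul_polyC dvdp_mull // subrXX dvdp_mulr.
Qed.

Lemma root0_dvdX p : p`_0 = 0 -> 'X %| p.
Proof. by move=> p0; apply/(dvdXnP 1) => -[|]. Qed.

Definition exp_poly N : {poly K} := \poly_(k < N.+1) k`!%:R^-1.

Definition log1p_poly N : {poly K} :=
  \poly_(k < N.+1) (if k is 0 then 0 else (-1) ^+ k.-1 / k%:R).

Lemma deriv_exp_poly N :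
  (exp_poly N)^`() = exp_poly N - (N`!%:R^-1)%:P * 'X^N.
Proof.
apply/polyP => i; rewrite coef_deriv coefB coefCM coefXn !coef_poly !ltnS.
case: (ltngtP i N) => [iN||->]; rewrite ?mulr0 ?mul0rn ?mulr1 ?subr0 //.
  by rewrite -[LHS]mulr_natr factS natrM invfM mulrAC mulVf ?mul1r ?pnatr_eq0.
by rewrite subrr.
Qed.

(** The derivative is a finite geometric sum in [- 'X], which telescopes against [1 + 'X]. *)
Lemma deriv_log1p_poly N :
  (1 + 'X) * (log1p_poly N)^`() = 1 - (- 'X) ^+ N.
Proof.
have -> : (log1p_poly N)^`() = \sum_(i < N) (- 'X) ^+ i.
  transitivity (\poly_(i < N) ((-1) ^+ i : K)).
    apply/polyP => i; rewrite coef_deriv !coef_poly ltnS.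
    case: ifP => _; last exact: mul0rn.
    by rewrite -[LHS]mulr_natr divfK // pnatr_eq0.
  rewrite poly_def; apply: eq_bigr => i _.
  by rewrite [RHS]exprNn -mul_polyC polyC_exp polyCN.
by rewrite -opprB subrX1 -mulNr opprB opprK.
Qed.

Lemma log1p_exp_poly N :
  'X^(N.+1) %| (log1p_poly N \Po (exp_poly N - 1)) - 'X.
Proof.
set Y := exp_poly N - 1; set Q := _ \Po Y.
have X_dvd_Y : 'X %| Y.
  by apply: root0_dvdX; rewrite coefB coef_poly /= coef1 fact0 invr1 subrr.
(* As [log1p_poly N] has no constant term, [Y] divides [Q], and ['X] divides [Y]. *)
have Q0 : Q`_0 = 0.
  suff : 'X^1 %| Q by move/dvdXnP => ->.
  apply: dvdp_trans X_dvd_Y _.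
  rewrite -[Y in Y %| _](comp_polyX Y) dvdp_comp_poly // root0_dvdX //.
  by rewrite coef_poly.
have dQ : 'X^N %| Q^`() - 1.
  have dY : Y^`() = 1 + Y - (N`!%:R^-1)%:P * 'X^N.
    by rewrite derivB deriv_exp_poly -polyC1 derivC subr0 addrCA subrr addr0.
  rewrite /Q deriv_comp dY mulrBr mulrA.
  have -> : ((log1p_poly N)^`() \Po Y) * (1 + Y) = 1 - (- Y) ^+ N.
    have /(congr1 (fun p => p \Po Y)) := deriv_log1p_poly N.
    rewrite comp_polyM mulrC comp_polyB comp_polyD rmorphXn rmorphN /=.
    by rewrite comp_polyX comp_polyC.
  (* Both error terms are multiples of ['X^N]: [(- Y) ^+ N] because ['X %| Y], and the other from
     the top term lost in differentiating [exp_poly N]. *)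
  rewrite addrAC [1 - _ - 1]addrAC subrr sub0r -opprD.
  rewrite dvdpNr dvdp_add ?dvdp_mull //.
  by apply: dvdp_exp2r; rewrite dvdpNr.
apply/dvdXnP => -[|i] iN; rewrite coefB coefX ?Q0 ?subr0 //=.
have /dvdXnP/(_ i iN) := dQ.
rewrite coefB coef_deriv coef1.
case: i iN => [|i] iN //=.
by rewrite mulr0n !subr0 => /eqP; rewrite mulrn_eq0 => /eqP.
Qed.

(** Substituting [p] turns ['X^(N.+1)] into [p ^+ N.+1], still a multiple of ['X^(N.+1)] because
    ['X] divides [p]. *)
Lemma log1p_poly_exp_comp N p : p`_0 = 0 ->
  'X^(N.+1) %| (log1p_poly N \Po ((exp_poly N - 1) \Po p)) - p.
Proof.
move=> p0; rewrite comp_polyA -[p in _ - p]comp_polyX -rmorphB /=.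
have /(dvdp_comp_poly p) := log1p_exp_poly N.
apply: dvdp_trans; rewrite comp_Xn_poly.
by apply: dvdp_exp2r; apply: root0_dvdX.
Qed.

End TruncatedPolynomials.

(** * Formal power series and their truncations *)

Section FormalPowerSeries.
Variable R : realType.
Implicit Types f g : nat -> R.

Definition trunc_fps N f : {poly R} := \poly_(i < N.+1) f i.

Lemma coef_trunc_fpsX N f k n : (n <= N)%N ->
  (trunc_fps N f ^+ k)`_n = fps_pow f k n.
Proof.
elim: k n => [|k IH] n nN; first by rewrite expr0 coef1.
rewrite exprS coefM; apply: eq_bigr => i _.
by rewrite coef_poly IH ?(leq_trans (leq_subr _ _)) // (leq_trans (ltn_ord i)).
Qed.

Lemma coef_poly_comp_trunc_fps M (c : nat -> R) N f n : (n <= N)%N ->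
  ((\poly_(k < M) c k) \Po trunc_fps N f)`_n =
  \sum_(k < M) c k * fps_pow f k n.
Proof.
move=> nN; rewrite poly_def linear_sum coef_sum; apply: eq_bigr => k _.
by rewrite linearZ /= comp_Xn_poly coefZ coef_trunc_fpsX.
Qed.

Lemma fps_pow0 f k : fps_pow f k 0 = f 0%N ^+ k.
Proof.
elim: k => [|k IH] //=; rewrite exprS -IH.
by rewrite /fps_mul big_ord_recl big_ord0 addr0.
Qed.

(** Each of the [k] factors contributes degree at least 1. *)
Lemma fps_pow_eq0 f k n : f 0%N = 0 -> (n < k)%N -> fps_pow f k n = 0.
Proof.
move=> f0; elim: k n => [|k IH] // n nk /=; apply: big1 => -[[|i] /= iN] _.
  by rewrite f0 mul0r.
rewrite IH ?mulr0 //; move: iN nk; case: n => // n _ nk.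
by rewrite subSS (leq_ltn_trans (leq_subr _ _)).
Qed.

(** In degree 0 the series is the one defining [expR], whatever [f 0] is; this later forces the
    cumulant of order 0 to vanish. *)
Lemma fps_exp0 f : fps_exp f 0 = expR (f 0%N).
Proof.
by congr (limn (series _)); apply/funext => k; rewrite fps_pow0.
Qed.

Lemma fps_expE f N n : f 0%N = 0 -> (n <= N)%N ->
  fps_exp f n = \sum_(k < N.+1) fps_pow f k n / k`!%:R.
Proof.
(* The partial sums are constant from [N.+1] on, since [f ^ k] starts in degree at least [k]. *)
move=> f0 nN; apply: lim_near_cst => //; near=> m.
have Nm : (N.+1 <= m)%N by near: m; exact: nbhs_infty_ge.
rewrite /series /= (big_cat_nat (leq0n _) Nm) //= big_mkord.
rewrite [X in _ + X]big_nat_cond.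
rewrite [X in _ + X]big1 ?addr0 // => k /andP[/andP[Nk _] _].
by rewrite fps_pow_eq0 ?mul0r // (leq_ltn_trans nN).
Unshelve. all: by end_near. Qed.

Lemma fps_log_exp f g N n : f 0%N = 0 -> fps_exp f =1 g -> (n <= N)%N ->
  \sum_(1 <= k < N.+1)
    (-1) ^+ k.-1 / k%:R * fps_pow (fun i => g i - (i == 0%N)%:R) k n = f n.
Proof.
move=> f0 fg nN; set h := fun i => g i - _.
(* The composite may have terms of degree above [N], so it must be truncated again; equality holds
   only modulo ['X^(N.+1)]. *)
have hE : trunc_fps N h =
    \poly_(i < N.+1) ((exp_poly R N - 1) \Po trunc_fps N f)`_i.
  apply/polyP => i; rewrite !coef_poly; case: ltnP => // iN.
  rewrite rmorphB rmorph1 coefB coef1 coef_poly_comp_trunc_fps // /h -fg.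
  rewrite (@fps_expE _ N) //; congr (_ - _).
  by apply: eq_bigr => k _; rewrite mulrC.
set E := _ \Po trunc_fps N f in hE.
have hE_dvd : 'X^(N.+1) %| trunc_fps N h - E.
  by apply/dvdXnP => i iN; rewrite hE coefB coef_poly iN subrr.
have f0' : (trunc_fps N f)`_0 = 0 by rewrite coef_poly.
have /dvdXnP/(_ n nN) : 'X^(N.+1) %|
    (log1p_poly R N \Po trunc_fps N h) - trunc_fps N f.
  rewrite -(subrK (log1p_poly R N \Po E) (_ \Po trunc_fps N h)) -addrA.
  rewrite dvdp_add ?log1p_poly_exp_comp //.
  exact: dvdp_trans hE_dvd (dvdp_sub_comp _ _ _).
rewrite coefB coef_poly ltnS nN coef_poly_comp_trunc_fps // => /subr0_eq <-.
(* The logarithm has zero coefficient at [k = 0], so the sum may start at 1. *)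
rewrite -(big_mkord xpredT (fun k =>
  (if k is 0 then 0 else (-1) ^+ k.-1 / k%:R) * fps_pow h k n)).
by rewrite [RHS]big_ltn // mul0r add0r; apply: eq_big_nat => -[].
Qed.

End FormalPowerSeries.

(** * Convolution powers as powers of exponential generating functions *)

Section ConvolutionPowers.
Variable R : realType.
Implicit Types (alpha beta : {scalar {poly R}}) (p : {poly R}).

Lemma egfK (a : nat -> R) n : n`!%:R * egf a n = a n.
Proof. by rewrite mulrC divfK // pnatr_eq0 -lt0n fact_gt0. Qed.

Lemma functional1 (m : nat -> R) : functional m 1 = m 0%N.
Proof. by rewrite -(expr0 'X) functionalXn. Qed.

(** The binomial coefficient over n! splits as 1/(k! (n-k)!). The sum is reversed because the
    coproduct puts degree n-k on the left factor. *)
Lemma egf_convolution alpha beta :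
  egf (fun n => convolution alpha beta 'X^n) =1
  fps_mul (egf (fun n => alpha 'X^n)) (egf (fun n => beta 'X^n)).
Proof.
move=> n; rewrite /egf convolutionXn mulr_suml (reindex_inj rev_ord_inj) /=.
apply: eq_bigr => i _; have iN : (i <= n)%N by rewrite -ltnS.
rewrite subSS subKn // bin_sub // -[in LHS]mulr_natr -(bin_fact iN) !natrM.
field; rewrite !pnatr_eq0 -!lt0n !fact_gt0 bin_gt0 /=.
by rewrite -ltnS.
Qed.

Lemma egf_convolution_power alpha k :
  egf (fun n => convolution_power alpha k 'X^n) =1
  fps_pow (egf (fun n => alpha 'X^n)) k.
Proof.
elim: k => [|k IH] n.
  rewrite /egf /convolution_power /= functionalXn.
  by case: n => [|n]; rewrite ?mul0r // divr1.
by rewrite [LHS]egf_convolution; apply: eq_bigr => i _; congr (_ * _).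
Qed.

Lemma convolution_powerXn alpha k n :
  convolution_power alpha k 'X^n =
  n`!%:R * fps_pow (egf (fun n => alpha 'X^n)) k n.
Proof. by rewrite -egf_convolution_power egfK. Qed.

(** All monomials of [p] have degree below [k], where the [k]-th power of a series without constant
    term vanishes. This yields pointwise finiteness. *)
Lemma convolution_power_eq0 alpha k p :
  alpha 1 = 0 -> (size p <= k)%N -> convolution_power alpha k p = 0.
Proof.
move=> alpha1 pk; rewrite scalar_polyE /functional big1 // => i _.
rewrite convolution_powerXn fps_pow_eq0 ?mulr0 //; last exact: leq_trans pk.
by rewrite /egf alpha1 mul0r.
Qed.

Lemma fsbig_ge1 (F : nat -> R) N : (forall n, (N <= n)%N -> F n = 0) ->
  \sum_(n \in [set n | (1 <= n)%N]) F n = \sum_(1 <= n < N) F n.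
Proof.
move=> F0; rewrite [RHS]fsbig_seq ?iota_uniq //; apply/esym/fsbig_widen.
  by move=> n /=; rewrite mem_index_iota => /andP[].
move=> n /= [n1 /negP]; rewrite mem_index_iota n1 /= -leqNgt; exact: F0.
Qed.

Lemma finite_support_ge1 (F : nat -> R) N :
  (forall n, (N <= n)%N -> F n = 0) ->
  finite_set [set n | (1 <= n)%N /\ F n != 0].
Proof.
move=> F0; apply: (sub_finite_set _ (finite_II N)) => n /= [_].
by apply: contraNltn => /F0/eqP.
Qed.

Lemma exp_convolutionE alpha p N : alpha 1 = 0 -> (size p <= N.+1)%N ->
  exp_convolution alpha p =
  \sum_(k < N.+1) k`!%:R^-1 * convolution_power alpha k p.
Proof.
(* The counit is the term [k = 0]. *)
move=> alpha1 pN; rewrite big_ord_recl fact0 invr1 mul1r; congr (_ + _).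
rewrite (@fsbig_ge1 _ N.+1) ?big_add1 ?big_mkord //.
by move=> n Nn; rewrite /exp_term convolution_power_eq0 ?mulr0 ?(leq_trans pN).
Qed.

Lemma log_convolutionE alpha p N : alpha 1 = 1 -> (size p <= N.+1)%N ->
  log_convolution alpha p = \sum_(1 <= k < N.+1) log_term alpha k p.
Proof.
move=> alpha1 pN; apply: fsbig_ge1 => n Nn.
rewrite /log_term convolution_power_eq0 ?mulr0 ?(leq_trans pN) //=.
by rewrite alpha1 functional1 subrr.
Qed.

Lemma egf_functional (m : nat -> R) : egf (fun n => functional m 'X^n) = egf m.
Proof. by apply/funext => n; rewrite /egf functionalXn. Qed.

Section Cumulants.
Variables moments kappa_ : nat -> R.
Hypotheses (kappa0 : kappa_ 0%N = 0) (Hkappa : are_cumulants moments kappa_).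

Let egf_kappa0 : egf kappa_ 0%N = 0.
Proof. by rewrite /egf kappa0 mul0r. Qed.

Lemma exp_convolution_cumulants :
  functional moments =1 exp_convolution (functional kappa_).
Proof.
move=> p; rewrite (@exp_convolutionE _ _ (size p)) /= ?functional1 //.
(* The single truncation order [size p] serves every monomial of [p], so exchanging the sums leaves
   one coefficient identity per degree. *)
under eq_bigr => k _ do rewrite scalar_polyE /functional mulr_sumr.
rewrite exchange_big; apply: eq_bigr => i _ /=.
rewrite -(egfK moments i) -Hkappa.
rewrite (@fps_expE _ _ (size p)) ?(ltnW (ltn_ord i)) // !mulr_sumr.
apply: eq_bigr => k _; rewrite convolution_powerXn egf_functional.
by rewrite [RHS]mulrC -!mulrA.
Qed.

Lemma log_convolution_moments : moments 0%N = 1 ->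
  functional kappa_ =1 log_convolution (functional moments).
Proof.
move=> moments0 p; rewrite (@log_convolutionE _ _ (size p)) /= ?functional1 //.
under eq_bigr => k _ do rewrite /log_term scalar_polyE /functional mulr_sumr.
rewrite exchange_big; apply: eq_bigr => i _ /=.
rewrite -(egfK kappa_ i).
rewrite -(fps_log_exp egf_kappa0 Hkappa (ltnW (ltn_ord i))) !mulr_sumr.
apply: eq_bigr => k _; rewrite convolution_powerXn.
rewrite [RHS]mulrCA; congr (_ * _); rewrite [RHS]mulrCA; congr (_ * (_ * _)).
(* Subtracting the counit changes only the coefficient of degree 0, where the factorial is 1. *)
congr (fps_pow _ k i); apply/funext => n.
rewrite /egf /= !functionalXn mulrBl; congr (_ - _).
by case: n => [|n]; rewrite ?mul0r // divr1.
Qed.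

End Cumulants.

End ConvolutionPowers.

Theorem theorem1p3 (d : measure_display) (T : measurableType d) (R : realType)
    (P : probability T R) (X : {RV P >-> R}) (kappa_ : nat -> R)
    (hX : finite_moments X) (hkappa : are_cumulants (moment X) kappa_) :
  let mu : {scalar {poly R}} := functional (moment X) in
  let kappa : {scalar {poly R}} := functional kappa_ in
  [/\ moment X 0%N = 1 /\ kappa_ 0%N = 0,
      pointwise_finite (exp_term kappa) /\ mu =1 exp_convolution kappa
    & pointwise_finite (log_term mu) /\ kappa =1 log_convolution mu].
Proof.
have moment0 : moment X 0%N = 1.
  by rewrite /moment (_ : (fun w => _) = cst 1) ?expectation_cst.
have kappa0 : kappa_ 0%N = 0.
  (* In degree 0 the cumulant identity reads exp(κ_0) = 1 = exp(0). *)
  have := hkappa 0%N; rewrite fps_exp0 /egf fact0 !divr1 moment0 -expR0.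
  exact: expR_inj.
split=> //; split.
- move=> p; apply: (@finite_support_ge1 _ _ (size p)) => n pn.
  by rewrite /exp_term convolution_power_eq0 ?mulr0 /= ?functional1.
- exact: exp_convolution_cumulants.
- move=> p; apply: (@finite_support_ge1 _ _ (size p)) => n pn.
  rewrite /log_term convolution_power_eq0 ?mulr0 //=.
  by rewrite !functional1 moment0 subrr.
- exact: log_convolution_moments.
Qed.
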